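(* There exists a cubic graph $G$ with perfect matching index $\pi(G)\le 4$ that does not admit a $P_{12}$-coloring.
   Context: The perfect matching index $\pi(G)$ of a graph $G$ is the smallest number of perfect matchings needed to cover all the edges of $G$. $P_{12}$ is the cubic graph on $12$ vertices obtained from the Petersen graph by replacing one vertex by a triangle (the three edges formerly incident to that vertex become incident to the three different vertices of the triangle). For cubic graphs $G,H$, an $H$-coloring of $G$ is a map $\varphi:E(G)\to E(H)$ such that for every vertex $v$ of $G$ there is a vertex $w$ of $H$ with $\varphi(\partial_G(v))=\partial_H(w)$, where $\partial$ denotes the set of edges incident to a vertex. *)

(* Defs.v *)
From HB Require Import structures.
From mathcomp Require Import all_boot all_order all_algebra.

Set Implicit Arguments.
Unset Strict Implicit.
Unset Printing Implicit Defensive.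

(* Finite simple graphs. *)
Record sgraph := SGraph {
  vertex :> finType;
  adj : rel vertex;
  adj_sym : symmetric adj;
  adj_irr : irreflexive adj
}.

Definition nbhd (G : sgraph) (v : G) : {set G} := [set u | adj v u].

Definition cubic (G : sgraph) : Prop := forall v : G, #|nbhd v| = 3.

(* An edge is the unordered pair of its ends. *)
Definition edges (G : sgraph) : {set {set G}} :=
  [set [set p.1; p.2] | p : G * G & adj p.1 p.2].

Definition incident (G : sgraph) (v : G) : {set {set G}} :=
  [set e in edges G | v \in e].

Definition perfect_matching (G : sgraph) (M : {set {set G}}) : bool :=
  (M \subset edges G) && [forall v : G, #|[set e in M | v \in e]| == 1].

Definition pm_cover (G : sgraph) (F : {set {set {set G}}}) : Prop :=
  {in F, forall M, perfect_matching M} /\ cover F = edges G.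

(* The index is a relation because some graphs (those with an edge that lies
   in no perfect matching) have no cover, hence no finite index. *)
Definition pm_index (G : sgraph) (k : nat) : Prop :=
  (exists2 F : {set {set {set G}}}, pm_cover F & #|F| = k) /\
  (forall F : {set {set {set G}}}, pm_cover F -> k <= #|F|).

(* A map E(G) -> E(H) is given by a function on all sets of vertices; its
   values outside E(G) are irrelevant. *)
Definition is_coloring (G H : sgraph) (phi : {set G} -> {set H}) : Prop :=
  {in edges G, forall e, phi e \in edges H} /\
  (forall v : G, exists w : H, phi @: incident v = incident w).

Definition admits_coloring (G H : sgraph) : Prop :=
  exists phi : {set G} -> {set H}, is_coloring phi.

(* (false, i) is on the outer pentagon, (true, i) on the inner pentagram. *)
Definition petersen_adj : rel (bool * 'Z_5) := fun x y =>
  if x.1 == y.1 then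
    let s : 'Z_5 := (if x.1 then 2%:R else 1)%R in
    (y.2 == x.2 + s)%R || (x.2 == y.2 + s)%R
  else x.2 == y.2.

Lemma petersen_adj_sym : symmetric petersen_adj.
Proof.
move=> [b i] [c j]; rewrite /petersen_adj /= (eq_sym c b) (eq_sym j i).
by case: eqP => // ->; rewrite orbC.
Qed.

Lemma petersen_adj_irr : irreflexive petersen_adj.
Proof. by move=> [[] [[|[|[|[|[|i]]]]] hi]]. Qed.

Definition petersen : sgraph := SGraph petersen_adj_sym petersen_adj_irr.

(* Replacing a vertex v by a clique with one vertex for each neighbor u of v,
   written [inr u]; the edge vu becomes the edge joining [inr u] to u. For a
   vertex of degree 3 the clique is a triangle. *)
Section Inflate.
Variables (G : sgraph) (v : G).

Definition inflate_vertex : finType :=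
  ({x : G | x != v} + {u : G | u \in nbhd v})%type.

Definition inflate_adj : rel inflate_vertex := fun a b =>
  match a, b with
  | inl x, inl y => adj (val x) (val y)
  | inl x, inr u => val x == val u
  | inr u, inl x => val x == val u
  | inr u, inr w => u != w
  end.

Lemma inflate_adj_sym : symmetric inflate_adj.
Proof. by move=> [x|u] [y|w] //=; [exact: adj_sym | rewrite eq_sym]. Qed.

Lemma inflate_adj_irr : irreflexive inflate_adj.
Proof. by move=> [x|u] /=; [exact: adj_irr | rewrite eqxx]. Qed.

Definition inflate : sgraph := SGraph inflate_adj_sym inflate_adj_irr.

End Inflate.

(* The Petersen graph is vertex-transitive, so the choice of the vertex does
   not matter. *)
Definition P12 : sgraph := @inflate petersen (false, 0%R).

(* Main.v *)
Require Import Defs.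
From mathcomp Require Import all_boot all_order all_algebra.

Set Implicit Arguments.
Unset Strict Implicit.
Unset Printing Implicit Defensive.

(** G is the Petersen graph with two adjacent vertices each replaced by a copy
    L of Petersen minus a vertex. A P12-coloring of G sends a 3-edge-cut to a
    3-edge-cut, that is, to the star of a vertex or to the cut T around the
    triangle of P12. The star is impossible for the cut around L: contracting
    the other side would give a P12-coloring of the Petersen graph, whose
    perfect matching index is 5. So both cuts are sent to T, and contracting
    them together with the triangle of P12 gives a Petersen coloring of the
    Petersen graph, that is, an automorphism, taking two vertices to the same
    one. Both steps are checked below by exhaustive search on colorings. *)

(** * Matchings and incidence in a graph *)

Section Graphs.
Variable G : sgraph.

Lemma incidentE (v : G) : incident v = [set [set v; u] | u in nbhd v].
Proof.
apply/setP=> e; rewrite !inE; apply/andP/imsetP.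
  case=> /imsetP[[x y]]; rewrite inE /= => xy -> /set2P[] ->.
    by exists y; rewrite ?inE.
  by exists x; rewrite ?inE 1?adj_sym // setUC.
case=> u; rewrite inE => vu ->; split; last by rewrite set21.
by apply/imsetP; exists (v, u); rewrite ?inE.
Qed.

(** [x] and [f x] give the same pair, so a vertex lies in only one. *)
Lemma involution_matching (f : G -> G) :
  involutive f -> (forall x, adj x (f x)) ->
  perfect_matching [set [set x; f x] | x : G].
Proof.
move=> fK adjf; apply/andP; split.
  apply/subsetP=> e /imsetP[x _ ->].
  by apply/imsetP; exists (x, f x); rewrite ?inE.
apply/forallP=> v; apply/cards1P; exists [set v; f v].
apply/setP=> e; rewrite !inE; apply/andP/eqP.
  by case=> /imsetP[x _ ->] /set2P[] -> //; rewrite fK setUC.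
by move=> ->; rewrite set21; split=> //; apply/imsetP; exists v.
Qed.

(** There are finitely many candidate covers, so once one exists a smallest one does, and its size
    is the index. *)
Lemma pm_index_le (F : {set {set {set G}}}) :
  pm_cover F -> exists2 k, pm_index G k & k <= #|F|.
Proof.
pose P (E : {set {set {set G}}}) := [forall M in E, perfect_matching M] && (cover E == edges G).
have coverP E : reflect (pm_cover E) (P E).
  by apply: (iffP andP) => -[/forall_inP H /eqP].
move/coverP=> covF; case: (@arg_minnP _ F P (fun E => #|E|) covF).
move=> E /coverP covE minE; exists #|E|; last exact: minE.
by split=> [|E' /coverP /minE //]; exists E.
Qed.

End Graphs.

(** * Exhaustive search *)

Section Search.
Variables K C : eqType.

(* [(ks, ts)] constrains the tuple of values at the keys [ks] to lie in [ts]. *)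
Definition constraint := (seq K * seq (seq C))%type.

Definition satisfies (psi : K -> C) (c : constraint) : bool :=
  map psi c.1 \in c.2.

Fixpoint lookup (a : seq (K * C)) (k : K) : option C :=
  if a is p :: a' then if p.1 == k then Some p.2 else lookup a' k else None.

(** A key with no value yet fits any entry. *)
Definition compatible (os : seq (option C)) (t : seq C) : bool :=
  all2 (fun o c => if o is Some d then d == c else true) os t.

(* The conditional, unlike [==>], keeps [vm_compute] from exploring pruned
   branches. *)
Fixpoint entails (cs : seq constraint) (a : seq (K * C)) (g : constraint) :=
  if cs is c :: cs' then
    let os := map (lookup a) c.1 in
    all (fun t => if compatible os t then entails cs' (zip c.1 t ++ a) g
                  else true) c.2
  else has (fun t => (size t == size g.1) && all (mem a) (zip g.1 t)) g.2.

Lemma compatible_lookup (psi : K -> C) a ks :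
  {in a, forall p, p.2 = psi p.1} -> compatible (map (lookup a) ks) (map psi ks).
Proof.
move=> psia; elim: ks => //= k ks IH; apply/andP; split=> //.
elim: a psia {IH} => //= p a IH psia; case: eqP => [<-|_].
  by rewrite psia ?mem_head.
by apply: IH => q qa; apply: psia; rewrite inE qa orbT.
Qed.

Lemma zip_map_self (psi : K -> C) ks :
  zip ks (map psi ks) = [seq (k, psi k) | k <- ks].
Proof. by elim: ks => //= k ks ->. Qed.

(** The branch that picks the values of [psi] at every constraint is never pruned, and its leaf
    checks the goal on those values. *)
Lemma entails_sound (psi : K -> C) cs a g :
  entails cs a g -> all (satisfies psi) cs ->
  {in a, forall p, p.2 = psi p.1} -> satisfies psi g.
Proof.
elim: cs a => [|c cs IH] a /=.
  case/hasP=> t tg /andP[/eqP szt /allP ta] _ psia.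
  rewrite /satisfies; suff -> : map psi g.1 = t by [].
  rewrite -{1}(@unzip1_zip _ _ g.1 t) ?szt //.
  rewrite -[RHS](@unzip2_zip _ _ g.1 t) ?szt //.
  rewrite -map_comp; apply/eq_in_map => p /ta pa /=; symmetry; exact: psia.
move=> /allP ent /andP[sc scs] psia.
have ga : {in [seq (k, psi k) | k <- c.1] ++ a, forall p, p.2 = psi p.1}.
  by move=> p; rewrite mem_cat => /orP[/mapP[k _ ->]|/psia].
have := ent _ sc; rewrite zip_map_self (compatible_lookup _ psia).
by move/IH; apply.
Qed.

End Search.

(** * A labelling of P12 *)

(* A vertex (b, i) of the Petersen graph gets the label i + 5b, and the triangle
   vertex attached to (b, i) the label 9 + i + 5b. *)
Definition petersen_label (x : bool * 'Z_5) : nat := x.2 + 5 * x.1.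

Definition P12_label (x : P12) : nat :=
  match x with
  | inl y => petersen_label (val y)
  | inr u => 9 + petersen_label (val u)
  end.

Definition P12_labels : seq nat := [:: 1; 2; 3; 4; 5; 6; 7; 8; 9; 10; 13; 14].

(** Row 0 stands for the vertex replaced by the triangle 10, 13, 14; the labels 11 and 12 name no
    vertex. *)
Definition P12_nbrs (k : nat) : seq nat :=
  nth [::] [:: [::]; [:: 10; 2; 6]; [:: 1; 3; 7]; [:: 2; 4; 8]; [:: 13; 3; 9];
    [:: 14; 7; 8]; [:: 1; 8; 9]; [:: 2; 5; 9]; [:: 3; 5; 6]; [:: 4; 6; 7];
    [:: 1; 13; 14]; [::]; [::]; [:: 4; 10; 14]; [:: 5; 10; 13]] k.

Lemma P12_label_mem x : P12_label x \in P12_labels.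
Proof.
case: x => [[[[] [[|[|[|[|[|i]]]]] hi]] hx]|[[[] [[|[|[|[|[|i]]]]] hi]] hx]] //;
by exfalso; move: hx; rewrite ?inE.
Qed.

Lemma P12_label_onto k : k \in P12_labels -> exists x, P12_label x = k.
Proof.
have pt (b : bool) (i : 'Z_5) : (b, i) != (false, 0%R) :> petersen ->
    exists x, P12_label x = petersen_label (b, i).
  by move=> bi; exists (inl (exist _ (b, i) bi)).
have tr (b : bool) (i : 'Z_5) : (b, i) \in nbhd ((false, 0%R) : petersen) ->
    exists x, P12_label x = 9 + petersen_label (b, i).
  by move=> bi; exists (inr (exist _ (b, i) bi)).
rewrite !inE.
do 11 ?[case/orP]; move/eqP->.
- exact: (pt false (@Ordinal 5 1 isT)).
- exact: (pt false (@Ordinal 5 2 isT)).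
- exact: (pt false (@Ordinal 5 3 isT)).
- exact: (pt false (@Ordinal 5 4 isT)).
- exact: (pt true (@Ordinal 5 0 isT)).
- exact: (pt true (@Ordinal 5 1 isT)).
- exact: (pt true (@Ordinal 5 2 isT)).
- exact: (pt true (@Ordinal 5 3 isT)).
- exact: (pt true (@Ordinal 5 4 isT)).
- by apply: (tr false (@Ordinal 5 1 isT)); rewrite inE.
- by apply: (tr false (@Ordinal 5 4 isT)); rewrite inE.
- by apply: (tr true (@Ordinal 5 0 isT)); rewrite inE.
Qed.

Lemma P12_adjE (x y : P12) : adj x y = (P12_label y \in P12_nbrs (P12_label x)).
Proof.
case: x => [[[[] [[|[|[|[|[|i]]]]] hi]] hx]|[[[] [[|[|[|[|[|i]]]]] hi]] hx]] //;
try (by exfalso; move: hx; rewrite ?inE);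
case: y => [[[[] [[|[|[|[|[|j]]]]] hj]] hy]|[[[] [[|[|[|[|[|j]]]]] hj]] hy]] //;
by exfalso; move: hy; rewrite ?inE.
Qed.

(* An edge of P12 is encoded by the increasing list of the labels of its ends. *)
Definition pair_code (k l : nat) : seq nat :=
  [seq m <- iota 0 15 | (m == k) || (m == l)].

Definition edge_code (e : {set P12}) : seq nat :=
  [seq m <- iota 0 15 | [exists x in e, m == P12_label x]].

Lemma edge_code_set2 x y :
  edge_code [set x; y] = pair_code (P12_label x) (P12_label y).
Proof.
apply: eq_filter => m; apply/exists_inP/orP.
  by case=> z /set2P[] -> mz; [left | right].
by case=> mz; [exists x | exists y]; rewrite ?set21 ?set22.
Qed.

Definition P12_star (k : nat) : seq (seq nat) :=
  [seq pair_code k l | l <- P12_nbrs k].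

(** All orders occur, since a coloring prescribes only the set of colors at a vertex. *)
Definition star_colorings : seq (seq (seq nat)) :=
  flatten [seq permutations (P12_star k) | k <- P12_labels].

Lemma P12_star_uniq k : k \in P12_labels -> uniq (P12_star k) && (size (P12_star k) == 3).
Proof. by apply: (@allP _ (fun k => _ && _)); vm_compute. Qed.

Lemma P12_nbrs_sub k : k \in P12_labels -> {subset P12_nbrs k <= P12_labels}.
Proof.
by move=> kL; apply/allP; move: k kL; apply/allP; vm_compute.
Qed.

(** * The graph *)

(* Vertices 0 to 7 are the Petersen graph minus its vertices 0 and 1, shifted by
   2; vertices 8 to 16 and 17 to 25 are copies of the Petersen graph minus 0. *)
Definition G_nbrs (k : nat) : seq nat :=
  nth [::] [:: [:: 1; 5; 20]; [:: 0; 2; 6]; [:: 1; 7; 11]; [:: 5; 6; 12];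
    [:: 6; 7; 21]; [:: 0; 3; 7]; [:: 1; 3; 4]; [:: 2; 4; 5];
    [:: 9; 13; 17]; [:: 8; 10; 14]; [:: 9; 11; 15]; [:: 2; 10; 16];
    [:: 3; 14; 15]; [:: 8; 15; 16]; [:: 9; 12; 16]; [:: 10; 12; 13];
    [:: 11; 13; 14];
    [:: 8; 18; 22]; [:: 17; 19; 23]; [:: 18; 20; 24]; [:: 0; 19; 25];
    [:: 4; 23; 24]; [:: 17; 24; 25]; [:: 18; 21; 25]; [:: 19; 21; 22];
    [:: 20; 22; 23]] k.

(** Reduces a claim about all vertices to a boolean that [vm_compute] decides. *)
Lemma all_iota_ord n (P : pred nat) : all P (iota 0 n) -> forall x : 'I_n, P x.
Proof. by move/allP=> PP x; apply: PP; rewrite mem_iota /= add0n. Qed.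

Definition G_adj : rel 'I_26 := fun x y => val y \in G_nbrs x.

Lemma G_adj_sym : symmetric G_adj.
Proof.
move=> x y; apply/eqP.
pose P k := all (fun l => (l \in G_nbrs k) == (k \in G_nbrs l)) (iota 0 26).
have Px : P x by move: x; apply: (@all_iota_ord 26 P); vm_compute.
exact: (all_iota_ord Px).
Qed.

Lemma G_adj_irr : irreflexive G_adj.
Proof.
move=> x; apply/negbTE; move: x.
by apply: (@all_iota_ord 26 (fun k => k \notin G_nbrs k)); vm_compute.
Qed.

Definition G : sgraph := SGraph G_adj_sym G_adj_irr.

Lemma G_nbrs_wf (v : 'I_26) :
  [&& uniq (G_nbrs v), size (G_nbrs v) == 3 & all (gtn 26) (G_nbrs v)].
Proof.
move: v; apply: (@all_iota_ord 26 (fun k =>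
  [&& uniq (G_nbrs k), size (G_nbrs k) == 3 & all (gtn 26) (G_nbrs k)])).
by vm_compute.
Qed.

Lemma card_ord_seq n (s : seq nat) :
  uniq s -> all (gtn n) s -> #|[set x : 'I_n | val x \in s]| = size s.
Proof.
move=> us /allP ltn_s; rewrite cardE -(size_map val).
apply/perm_size/uniq_perm => //; first by rewrite (map_inj_uniq val_inj) enum_uniq.
move=> k; apply/mapP/idP => [[x]|ks]; first by rewrite mem_enum inE => xs ->.
by exists (Ordinal (ltn_s k ks)); rewrite // mem_enum inE.
Qed.

Lemma G_cubic : cubic G.
Proof.
move=> v; have /and3P[us /eqP sz lts] := G_nbrs_wf v.
exact: etrans (card_ord_seq us lts) sz.
Qed.

(* Row i lists the partner of each vertex in the i-th matching; rows 1 and 3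
   each contain a whole cut around a copy of Petersen minus a vertex. *)
Definition G_mates : seq (seq nat) :=
  [:: [:: 1; 0; 11; 6; 21; 7; 3; 5; 9; 8; 15; 2; 14; 16; 12; 10; 13; 18; 17; 20;
          19; 4; 24; 25; 22; 23];
      [:: 5; 6; 11; 12; 7; 0; 1; 4; 17; 10; 9; 2; 3; 15; 16; 13; 14; 8; 19; 18;
          25; 23; 24; 21; 22; 20];
      [:: 20; 2; 1; 12; 6; 7; 4; 5; 13; 14; 15; 16; 3; 8; 9; 10; 11; 22; 19; 18;
          0; 24; 17; 25; 21; 23];
      [:: 20; 6; 7; 5; 21; 3; 1; 2; 17; 14; 11; 10; 15; 16; 9; 12; 13; 8; 23; 24;
          0; 4; 25; 18; 19; 22]].

Definition mate (i : nat) (x : G) : G := inord (nth 0 (nth [::] G_mates i) x).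

Definition G_matching (i : nat) : {set {set G}} := [set [set x; mate i x] | x : G].

Lemma mate_spec i (x : G) : i < 4 ->
  [/\ adj x (mate i x), mate i (mate i x) = x &
      mate i x = nth 0 (nth [::] G_mates i) x :> nat].
Proof.
move=> lti; pose m k := nth 0 (nth [::] G_mates i) k.
have /and3P[mx xm /eqP mm] : [&& m x < 26, m x \in G_nbrs x & m (m x) == x].
  move: x; apply: (@all_iota_ord 26 (fun k =>
    [&& m k < 26, m k \in G_nbrs k & m (m k) == k])).
  by rewrite /m; case: i lti {m} => [|[|[|[|i]]]] // _; vm_compute.
have valm : mate i x = m x :> nat by rewrite /mate inordK.
split=> //; first by rewrite /= /G_adj /= valm.
by apply: val_inj; rewrite /= {1}/mate valm -/(m _) mm inord_val.
Qed.

Lemma G_cover : pm_cover [set G_matching i | i : 'I_4].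
Proof.
have mP i : i < 4 -> perfect_matching (G_matching i).
  by move=> lti; apply: involution_matching => x; have [] := mate_spec x lti.
split=> [M /imsetP[i _ ->]|]; first exact: mP.
apply/setP=> e; apply/bigcupP/imsetP.
  case=> M /imsetP[i _ ->] eM.
  have /andP[/subsetP /(_ e eM) /imsetP ex _] := mP i (ltn_ord i); exact: ex.
case=> -[x y]; rewrite inE /= => xy ->.
(* Each neighbor of [x] is its mate in one of the four rows. *)
have : all (fun l => has (fun i => nth 0 (nth [::] G_mates i) x == l) (iota 0 4))
         (G_nbrs x).
  move: x {xy}; apply: (@all_iota_ord 26 (fun k => all (fun l =>
    has (fun i => nth 0 (nth [::] G_mates i) k == l) (iota 0 4)) (G_nbrs k))).
  by vm_compute.
move/allP/(_ _ xy)/hasP=> [i]; rewrite mem_iota /= add0n => lti /eqP mxy.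
exists (G_matching i); first by apply/imsetP; exists (Ordinal lti).
apply/imsetP; exists x => //; congr [set _; _]; apply: val_inj.
have [_ _ mx] := mate_spec x lti; exact: etrans (esym mxy) (esym mx).
Qed.

(** * No coloring *)

(** Sorting gives an edge the same key from both ends. *)
Definition G_key (k l : nat) : nat * nat := (minn k l, maxn k l).

Definition vertex_constraint (k : nat) : constraint (nat * nat)%type (seq nat) :=
  ([seq G_key k l | l <- G_nbrs k], star_colorings).

Definition triangle_cut_colorings : seq (seq (seq nat)) :=
  permutations [:: pair_code 1 10; pair_code 4 13; pair_code 5 14].

(** These edges leave the copy on 8 to 16; the edge 8-17 joins the two copies and lies in both
    cuts. *)
Definition cut1 : constraint (nat * nat)%type (seq nat) :=
  ([:: (2, 11); (3, 12); (8, 17)], triangle_cut_colorings).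

Definition cut2 : constraint (nat * nat)%type (seq nat) :=
  ([:: (0, 20); (4, 21); (8, 17)], triangle_cut_colorings).

(* The vertices are ordered so that short cycles are closed early. *)
Definition copy1 : seq nat := [:: 13; 8; 9; 10; 15; 11; 16; 14; 12].

Definition copy2 : seq nat := [:: 22; 17; 18; 19; 24; 20; 25; 23; 21].

Lemma copy1_entails : entails (map vertex_constraint copy1) [::] cut1.
Proof. by vm_compute. Qed.

Lemma copy2_entails : entails (map vertex_constraint copy2) [::] cut2.
Proof. by vm_compute. Qed.

(** No map satisfies a goal with no allowed tuple, so the check succeeds only if every branch
    dies. *)
Lemma cuts_contradictory :
  entails [:: cut1, cut2 & map vertex_constraint (iota 0 8)] [::] ([::], [::]).
Proof. by vm_compute. Qed.

Section NoColoring.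
Variable phi : {set G} -> {set P12}.
Hypothesis phiP : is_coloring phi.

Definition key_color (k : nat * nat) : seq nat :=
  edge_code (phi [set (inord k.1 : G); (inord k.2 : G)]).

Lemma key_color_adj (v u : G) :
  key_color (G_key v u) = edge_code (phi [set v; u]).
Proof.
congr (edge_code (phi _)); rewrite /G_key /=.
by case: leqP => _; rewrite !inord_val // setUC.
Qed.

Lemma vertex_constraint_satisfied (v : G) : satisfies key_color (vertex_constraint v).
Proof.
have [w vw] := phiP.2 v.
have /and3P[us /eqP szs lts] := G_nbrs_wf v.
pose s := map key_color [seq G_key v l | l <- G_nbrs v].
have Lw := P12_label_mem w.
have /andP[uT /eqP szT] := P12_star_uniq Lw.
(* [phi] maps the edges at [v] onto the star of [w]. *)
have sub : {subset P12_star (P12_label w) <= s}.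
  move=> c /mapP[l lw ->].
  have [y yl] := P12_label_onto (P12_nbrs_sub Lw lw).
  have : [set w; y] \in phi @: incident v.
    by rewrite vw incidentE; apply/imsetP; exists y; rewrite // inE P12_adjE yl.
  case/imsetP=> e; rewrite incidentE => /imsetP[u]; rewrite inE => vu -> wy.
  rewrite -yl -edge_code_set2 wy -key_color_adj.
  by do 2 apply: map_f.
(* Three colors that include the three distinct edges of a star are a permutation of it. *)
have szs3 : size s <= size (P12_star (P12_label w)) by rewrite !size_map szs -szT size_map.
have [_ eqs] := uniq_min_size uT sub szs3.
apply/flattenP; exists (permutations (P12_star (P12_label w))).
  by apply/mapP; exists (P12_label w).
rewrite mem_permutations perm_sym uniq_perm //.
exact: leq_size_uniq uT sub szs3.
Qed.

Lemma all_vertex_constraints (ks : seq nat) :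
  all (gtn 26) ks -> all (satisfies key_color) (map vertex_constraint ks).
Proof.
move=> /allP lt26; apply/allP=> c /mapP[k /lt26 ltk ->].
exact: (vertex_constraint_satisfied (Ordinal ltk)).
Qed.

Lemma coloring_absurd : False.
Proof.
have cut1P : satisfies key_color cut1.
  by apply: (entails_sound copy1_entails) => //; apply: all_vertex_constraints.
have cut2P : satisfies key_color cut2.
  by apply: (entails_sound copy2_entails) => //; apply: all_vertex_constraints.
suff : satisfies key_color ([::], [::]) by [].
apply: (entails_sound cuts_contradictory) => //.
apply/andP; split; first exact: cut1P.
apply/andP; split; first exact: cut2P.
exact: (all_vertex_constraints (ks := iota 0 8) isT).
Qed.

End NoColoring.

Theorem mainTheorem4 :
  exists G : sgraph,
    [/\ cubic G,
        exists2 k : nat, pm_index G k & k <= 4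
      & ~ admits_coloring G P12].
Proof.
exists G; split; first exact: G_cubic.
  have [k kG lek] := pm_index_le G_cover; exists k => //.
  by rewrite (leq_trans lek) // (leq_trans (leq_imset_card _ _)) // card_ord.
by case=> phi; exact: coloring_absurd.
Qed.
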